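(* Let $p$ be a prime number and let $A$ be a (not necessarily commutative) domain that is a finitely generated module of rank $p^2$ over its center $Z$. Let $a \in A$ be an element with $a \notin Z$, and let $B_a = \{b \in A : ab = ba\}$ be the centralizer of $a$ in $A$. Then $B_a$ is a commutative ring. Moreover, the natural embedding $Z[a] \subseteq B_a$ induces an isomorphism of fields of fractions $\operatorname{Frac}(Z[a]) \cong \operatorname{Frac}(B_a)$.
   Context: Rings are associative and unital; a domain is a nonzero ring, not necessarily commutative, without zero divisors. The center $Z$ of a domain $A$ is a commutative integral domain; the rank of $A$ over $Z$ is the dimension $\dim_K(K \otimes_Z A)$, where $K$ is the fraction field of $Z$. An element of $A$ is called noncentral if it does not belong to $Z$. $Z[a]$ denotes the (commutative) subring of $A$ generated by $Z$ and $a$. *)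

(* Defs.v *)
From HB Require Import structures.
From mathcomp Require Import all_boot all_order all_algebra.
From mathcomp Require Import generic_quotient boolp.

Set Implicit Arguments.
Unset Strict Implicit.
Unset Printing Implicit Defensive.

Import GRing.Theory.
Local Open Scope ring_scope.
Local Open Scope quotient_scope.

(* The library's [idomainType] is commutative with decidable units; here only
   the absence of zero divisors is required. *)
HB.mixin Record NzRing_isDomain A of GRing.NzRing A := {
  domain_mulf_eq0 : GRing.integral_domain_axiom A }.

#[short(type="domainType")]
HB.structure Definition Domain := { A of NzRing_isDomain A & GRing.NzRing A }.

Section CommutativeSubrings.
Variable A : domainType.

Structure comSubring := ComSubring {
  com_subring_pred :> {pred A};
  com_subring_closed : subring_closed com_subring_pred;
  com_subring_comm : {in com_subring_pred &, forall x y, x * y = y * x} }.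

Record com_subring (S : comSubring) := InComSubring {
  com_subring_val : A;
  com_subring_valP : com_subring_pred S com_subring_val }.

Variable S : comSubring.

HB.instance Definition _ := [isSub for @com_subring_val S].
HB.instance Definition _ := [Choice of com_subring S by <:].
HB.instance Definition _ := GRing.SubChoice_isSubNzRing.Build A
  (com_subring_pred S) (com_subring S) (@com_subring_closed S).

Lemma com_subring_mulC : commutative (@GRing.mul (com_subring S)).
Proof.
move=> x y; apply: val_inj; rewrite !rmorphM /=.
by apply: (@com_subring_comm S); [exact: (valP x) | exact: (valP y)].
Qed.

HB.instance Definition _ :=
  GRing.PzRing_hasCommutativeMul.Build (com_subring S) com_subring_mulC.

Definition com_subring_unit : {pred com_subring S} :=
  fun x => `[< exists y, y * x = 1 >].

Definition com_subring_inv (x : com_subring S) : com_subring S :=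
  if pselect (exists y, y * x = 1) is left h then projT1 (cid h) else x.

Lemma com_subring_mulVx :
  {in com_subring_unit, left_inverse 1 com_subring_inv *%R}.
Proof.
move=> x /asboolP hx; rewrite /com_subring_inv.
by case: pselect => // h; case: (cid h).
Qed.

Lemma com_subring_unitPl (x y : com_subring S) :
  y * x = 1 -> com_subring_unit x.
Proof. by move=> yx; apply/asboolP; exists y. Qed.

Lemma com_subring_inv_out : {in [predC com_subring_unit], com_subring_inv =1 id}.
Proof.
move=> x /asboolP hx; rewrite /com_subring_inv.
by case: pselect.
Qed.

HB.instance Definition _ := GRing.ComNzRing_hasMulInverse.Build (com_subring S)
  com_subring_mulVx com_subring_unitPl com_subring_inv_out.

Lemma com_subring_integral : GRing.integral_domain_axiom (com_subring S).
Proof.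
move=> x y /(congr1 val); rewrite rmorphM rmorph0 => /domain_mulf_eq0.
by rewrite -!(inj_eq val_inj) rmorph0.
Qed.

HB.instance Definition _ :=
  GRing.ComUnitRing_isIntegral.Build (com_subring S) com_subring_integral.

End CommutativeSubrings.

Coercion com_subring : comSubring >-> Sortclass.

Definition com_subring_incl (A : domainType) (S T : comSubring A)
    (sST : {subset S <= T}) (x : com_subring S) : com_subring T :=
  InComSubring (sST _ (com_subring_valP x)).

Section Subrings.
Variable A : domainType.

Definition center : {pred A} := fun z => `[< forall x, GRing.comm z x >].

Definition centralizer (a : A) : {pred A} := fun b => a * b == b * a.

(* The subring generated by the center and [a]. *)
Definition adjoin (a : A) : {pred A} := fun x =>
  `[< forall S : {pred A}, subring_closed S -> {subset center <= S} ->
        a \in S -> x \in S >].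

Lemma centerP z : reflect (forall x, GRing.comm z x) (z \in center).
Proof. exact: asboolP. Qed.

Lemma centralizerP a b : reflect (GRing.comm a b) (b \in centralizer a).
Proof. exact: eqP. Qed.

Lemma adjoinP a x :
  reflect (forall S : {pred A}, subring_closed S -> {subset center <= S} ->
             a \in S -> x \in S) (x \in adjoin a).
Proof. exact: asboolP. Qed.

Lemma center_subring_closed : subring_closed center.
Proof.
split=> [|x y /centerP hx /centerP hy|x y /centerP hx /centerP hy];
  apply/centerP => t; apply: commr_sym.
- exact: commr1.
- exact: commrB (commr_sym (hx t)) (commr_sym (hy t)).
- exact: commrM (commr_sym (hx t)) (commr_sym (hy t)).
Qed.

Lemma center_comm : {in center &, forall x y, x * y = y * x}.
Proof. by move=> x y /centerP hx _; apply: hx. Qed.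

Lemma centralizer_subring_closed a : subring_closed (centralizer a).
Proof.
split=> [|x y /centralizerP hx /centralizerP hy|x y];
  last move=> /centralizerP hx /centralizerP hy; apply/centralizerP.
- exact: commr1.
- exact: commrB.
- exact: commrM.
Qed.

Lemma adjoin_subring_closed a : subring_closed (adjoin a).
Proof.
split=> [|x y /adjoinP hx /adjoinP hy|x y /adjoinP hx /adjoinP hy];
  apply/adjoinP => S rS sZS aS; case: (rS) => S1 SB SM.
- exact: S1.
- by apply: SB; [apply: hx | apply: hy].
- by apply: SM; [apply: hx | apply: hy].
Qed.

Lemma adjoin_sub_centralizer a : {subset adjoin a <= centralizer a}.
Proof.
move=> x /adjoinP; apply; first exact: centralizer_subring_closed.
  by move=> z /centerP hz; apply/centralizerP/commr_sym.
exact/centralizerP.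
Qed.

Lemma adjoin_comm a : {in adjoin a &, forall x y, x * y = y * x}.
Proof.
move=> x y /adjoin_sub_centralizer/centralizerP ax /adjoinP ay.
apply/centralizerP/ay; first exact: centralizer_subring_closed.
  by move=> z /centerP hz; apply/centralizerP/commr_sym.
exact/centralizerP/commr_sym.
Qed.

Definition centerRing : comSubring A :=
  ComSubring center_subring_closed center_comm.

Definition adjoinRing (a : A) : comSubring A :=
  ComSubring (@adjoin_subring_closed a) (@adjoin_comm a).

Definition centralizerRing (a : A)
    (comm_a : {in centralizer a &, forall x y, x * y = y * x}) : comSubring A :=
  ComSubring (@centralizer_subring_closed a) comm_a.

Definition adjoin_incl (a : A)
    (comm_a : {in centralizer a &, forall x y, x * y = y * x}) :
    adjoinRing a -> centralizerRing comm_a :=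
  @com_subring_incl A (adjoinRing a) (centralizerRing comm_a)
    (@adjoin_sub_centralizer a).

End Subrings.

Arguments center : clear implicits.
Arguments centerRing : clear implicits.

Definition centerModule (A : domainType) : Type := A.

Section CenterModule.
Variable A : domainType.

HB.instance Definition _ := GRing.Zmodule.on (centerModule A).

Definition center_scale (z : centerRing A) (x : centerModule A) :
  centerModule A := (val z : A) * (x : A).

Lemma center_scaleA z t x :
  center_scale z (center_scale t x) = center_scale (z * t) x.
Proof. by rewrite /center_scale rmorphM mulrA. Qed.

Lemma center_scale1 : left_id 1 center_scale.
Proof. by move=> x; rewrite /center_scale rmorph1 mul1r. Qed.

Lemma center_scaleDr : right_distributive center_scale +%R.
Proof. by move=> z x y; rewrite /center_scale; apply: mulrDr. Qed.

Lemma center_scaleDl x : {morph center_scale^~ x : z t / z + t}.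
Proof. by move=> z t; rewrite /center_scale rmorphD; apply: mulrDl. Qed.

HB.instance Definition _ := GRing.Zmodule_isLmodule.Build (centerRing A)
  (centerModule A) center_scaleA center_scale1 center_scaleDr center_scaleDl.

End CenterModule.

Section BaseChange.
Variables (R K : comNzRingType) (f : {rmorphism R -> K}) (M : lmodType R).

(* A list stands for the formal sum of the tensors [u.1 (x) u.2] of its entries
   [u]; no formal opposites are needed since [- (c (x) m) = (- c) (x) m].
   [TensorZero] is not redundant: without opposites, additivity only makes
   [0 (x) m] idempotent. *)
Inductive tensor_eq : seq (K * M) -> seq (K * M) -> Prop :=
  | TensorRefl s : tensor_eq s s
  | TensorSym s t : tensor_eq s t -> tensor_eq t s
  | TensorTrans s t u : tensor_eq s t -> tensor_eq t u -> tensor_eq s u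
  | TensorCat s s' t t' :
      tensor_eq s s' -> tensor_eq t t' -> tensor_eq (s ++ t) (s' ++ t')
  | TensorCatC s t : tensor_eq (s ++ t) (t ++ s)
  | TensorZero m : tensor_eq [:: (0, m)] [::]
  | TensorDl c d m : tensor_eq [:: (c + d, m)] [:: (c, m); (d, m)]
  | TensorDr c m n : tensor_eq [:: (c, m + n)] [:: (c, m); (c, n)]
  | TensorBalanced c r m : tensor_eq [:: (c * f r, m)] [:: (c, r *: m)].

Definition tensor_eqb : rel (seq (K * M)) := fun s t => `[< tensor_eq s t >].

Lemma tensor_eqb_refl : reflexive tensor_eqb.
Proof. by move=> s; apply/asboolP; constructor. Qed.

Lemma tensor_eqb_sym : symmetric tensor_eqb.
Proof. by move=> s t; apply/asboolP/asboolP; apply: TensorSym. Qed.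

Lemma tensor_eqb_trans : transitive tensor_eqb.
Proof.
by move=> t s u /asboolP st /asboolP tu; apply/asboolP/(TensorTrans st tu).
Qed.

Canonical tensor_equiv :=
  EquivRel tensor_eqb tensor_eqb_refl tensor_eqb_sym tensor_eqb_trans.

(* The extension of scalars [K (x)_R M] along [f]. *)
Definition baseChange : Type := {eq_quot tensor_equiv}.

HB.instance Definition _ := Choice.on baseChange.

Definition tensor_class (s : seq (K * M)) : baseChange :=
  \pi_({eq_quot tensor_equiv}) s.

Definition tensor_repr (x : baseChange) : seq (K * M) :=
  repr (x : {eq_quot tensor_equiv}).

Lemma tensor_classP s t : tensor_class s = tensor_class t <-> tensor_eq s t.
Proof.
split; first by move=> /eqmodP /asboolP.
by move=> st; apply/eqmodP/asboolP.
Qed.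

Lemma tensor_reprK x : tensor_class (tensor_repr x) = x.
Proof. exact: reprK. Qed.

Lemma tensor_repr_class s : tensor_eq (tensor_repr (tensor_class s)) s.
Proof. by apply/tensor_classP; rewrite tensor_reprK. Qed.

Lemma tensor_classW (P : baseChange -> Prop) :
  (forall s, P (tensor_class s)) -> forall x, P x.
Proof. by move=> h x; rewrite -(tensor_reprK x). Qed.

Definition base_change_add (x y : baseChange) : baseChange :=
  tensor_class (tensor_repr x ++ tensor_repr y).

Definition base_change_scale (a : K) (x : baseChange) : baseChange :=
  tensor_class [seq (a * u.1, u.2) | u <- tensor_repr x].

Definition base_change_opp : baseChange -> baseChange := base_change_scale (-1).

Lemma tensor_eq_scale a s t : tensor_eq s t ->
  tensor_eq [seq (a * u.1, u.2) | u <- s] [seq (a * u.1, u.2) | u <- t].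
Proof.
elim=> {s t} [s|s t _|s t u _ st _ tu|s s' t t' _ h1 _ h2|s t|m|c d m|c m n|c r m].
- exact: TensorRefl.
- exact: TensorSym.
- exact: TensorTrans st tu.
- by rewrite !map_cat; apply: TensorCat.
- by rewrite !map_cat; apply: TensorCatC.
- by rewrite /= mulr0; apply: TensorZero.
- by rewrite /= mulrDr; apply: TensorDl.
- exact: TensorDr.
- by rewrite /= mulrA; apply: TensorBalanced.
Qed.

Lemma base_change_addE s t :
  base_change_add (tensor_class s) (tensor_class t) = tensor_class (s ++ t).
Proof. by apply/tensor_classP/TensorCat; apply: tensor_repr_class. Qed.

Lemma base_change_scaleE a s :
  base_change_scale a (tensor_class s) =
  tensor_class [seq (a * u.1, u.2) | u <- s].
Proof. by apply/tensor_classP/tensor_eq_scale/tensor_repr_class. Qed.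

Lemma base_change_addA : associative base_change_add.
Proof.
elim/tensor_classW=> s; elim/tensor_classW=> t; elim/tensor_classW=> u.
by rewrite !base_change_addE catA.
Qed.

Lemma base_change_addC : commutative base_change_add.
Proof.
elim/tensor_classW=> s; elim/tensor_classW=> t.
by rewrite !base_change_addE; apply/tensor_classP/TensorCatC.
Qed.

Lemma base_change_add0 : left_id (tensor_class [::]) base_change_add.
Proof. by elim/tensor_classW=> s; rewrite base_change_addE. Qed.

Lemma tensor_eq_scaleD a b s :
  tensor_eq [seq ((a + b) * u.1, u.2) | u <- s]
    ([seq (a * u.1, u.2) | u <- s] ++ [seq (b * u.1, u.2) | u <- s]).
Proof.
elim: s => [|[c m] s IH] /=; first exact: TensorRefl.
set X := map _ _; set Y := map _ _; set Z := map _ _; rewrite mulrDl.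
apply: (@TensorTrans _ ([:: (a * c, m); (b * c, m)] ++ (Y ++ Z))).
  exact: TensorCat (TensorDl _ _ _) IH.
suff: tensor_eq ([:: (a * c, m)] ++ (([:: (b * c, m)] ++ Y) ++ Z))
    ([:: (a * c, m)] ++ ((Y ++ [:: (b * c, m)]) ++ Z)) by rewrite -(catA Y).
apply: (TensorCat (TensorRefl [:: (a * c, m)])).
exact: (TensorCat (TensorCatC [:: (b * c, m)] Y) (TensorRefl Z)).
Qed.

Lemma tensor_eq_scale0 s : tensor_eq [seq (0 * u.1, u.2) | u <- s] [::].
Proof.
elim: s => [|[c m] s IH] /=; first exact: TensorRefl.
rewrite mul0r -cat1s -[[::]]/([::] ++ [::]).
exact: TensorCat (TensorZero _) IH.
Qed.

Lemma base_change_scaleA a b x :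
  base_change_scale a (base_change_scale b x) = base_change_scale (a * b) x.
Proof.
elim/tensor_classW: x => s; rewrite !base_change_scaleE -map_comp.
by congr tensor_class; apply: eq_map => u /=; rewrite mulrA.
Qed.

Lemma base_change_scale1 : left_id 1 base_change_scale.
Proof.
elim/tensor_classW=> s; rewrite base_change_scaleE; congr tensor_class.
by rewrite -[RHS]map_id; apply: eq_map => -[c m] /=; rewrite mul1r.
Qed.

Lemma base_change_scaleDr : right_distributive base_change_scale base_change_add.
Proof.
move=> a; elim/tensor_classW=> s; elim/tensor_classW=> t.
by rewrite !(base_change_addE, base_change_scaleE) map_cat.
Qed.

Lemma base_change_scaleDl x a b : base_change_scale (a + b) x =
  base_change_add (base_change_scale a x) (base_change_scale b x).
Proof.
elim/tensor_classW: x => s; rewrite !base_change_scaleE base_change_addE.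
exact/tensor_classP/tensor_eq_scaleD.
Qed.

Lemma base_change_addN :
  left_inverse (tensor_class [::]) base_change_opp base_change_add.
Proof.
move=> x; rewrite -{2}[x]base_change_scale1 -base_change_scaleDl addNr.
elim/tensor_classW: x => s; rewrite base_change_scaleE.
exact/tensor_classP/tensor_eq_scale0.
Qed.

HB.instance Definition _ := GRing.isZmodule.Build baseChange
  base_change_addA base_change_addC base_change_add0 base_change_addN.

HB.instance Definition _ := GRing.Zmodule_isLmodule.Build K baseChange
  base_change_scaleA base_change_scale1 base_change_scaleDr
  base_change_scaleDl.

Definition tensor (c : K) (m : M) : baseChange := tensor_class [:: (c, m)].

Lemma tensorDl c d m : tensor (c + d) m = tensor c m + tensor d m.
Proof. by rewrite [RHS]base_change_addE; apply/tensor_classP/TensorDl. Qed.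

Lemma tensorDr c m n : tensor c (m + n) = tensor c m + tensor c n.
Proof. by rewrite [RHS]base_change_addE; apply/tensor_classP/TensorDr. Qed.

Lemma tensor_balanced c r m : tensor (c * f r) m = tensor c (r *: m).
Proof. exact/tensor_classP/TensorBalanced. Qed.

Lemma tensorZ a c m : a *: tensor c m = tensor (a * c) m.
Proof. exact: base_change_scaleE. Qed.

Lemma tensor_classE s : tensor_class s = \sum_(u <- s) tensor u.1 u.2.
Proof.
elim: s => [|[c m] s IH]; first by rewrite big_nil.
by rewrite big_cons -IH; symmetry; apply: base_change_addE.
Qed.

Lemma tensor_universal (P : zmodType) (g : K -> M -> P) :
    (forall c d m, g (c + d) m = g c m + g d m) ->
    (forall c m n, g c (m + n) = g c m + g c n) ->
    (forall c r m, g (c * f r) m = g c (r *: m)) ->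
  exists! h : {additive baseChange -> P}, forall c m, h (tensor c m) = g c m.
Proof.
move=> gDl gDr gb.
have g0 m : g 0 m = 0 by apply: (addrI (g 0 m)); rewrite -gDl !addr0.
pose h (x : baseChange) : P := \sum_(u <- tensor_repr x) g u.1 u.2.
have gE s t : tensor_eq s t ->
    \sum_(u <- s) g u.1 u.2 = \sum_(u <- t) g u.1 u.2.
  elim=> {s t}.
  - by [].
  - by move=> s t _ ->.
  - by move=> s t u _ -> _ ->.
  - by move=> s s' t t' _ e1 _ e2; rewrite !big_cat e1 e2.
  - by move=> s t; rewrite !big_cat /= addrC.
  - by move=> m; rewrite big_seq1 big_nil /=.
  - by move=> c d m; rewrite !(big_cons, big_nil) /= !addr0.
  - by move=> c m n; rewrite !(big_cons, big_nil) /= !addr0.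
  - by move=> c r m; rewrite !big_seq1 /=.
have hE s : h (tensor_class s) = \sum_(u <- s) g u.1 u.2.
  exact/gE/tensor_repr_class.
have hD : {morph h : x y / x + y}.
  elim/tensor_classW=> s; elim/tensor_classW=> t.
  by rewrite [tensor_class s + _]base_change_addE !hE big_cat.
have h_0 : h 0 = 0 by rewrite [0 in LHS]/(tensor_class [::]) hE big_nil.
pose hN := GRing.isNmodMorphism.Build _ _ h (conj h_0 hD).
pose ha : {additive baseChange -> P} := HB.pack h hN.
exists ha; split=> [c m|h' h'E]; first by rewrite /= hE big_seq1.
suff eqh : ha =1 h'.
  case: ha h' eqh {h'E} => [u [[u1]]] [v [[v1]]] /= /funext euv.
  by case: _ / euv v1 => v1; rewrite (Prop_irrelevance u1 v1).
elim/tensor_classW=> s; rewrite /= hE tensor_classE raddf_sum.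
by apply: eq_bigr => u _; rewrite h'E.
Qed.

End BaseChange.

Definition has_dim (K : fieldType) (V : lmodType K) (n : nat) : Prop :=
  inhabited (Vector.axiom n V).

Definition has_rank (R : idomainType) (M : lmodType R) (n : nat) : Prop :=
  has_dim (baseChange (@tofrac R) M) n.

Definition fin_gen (R : nzRingType) (M : lmodType R) : Prop :=
  exists (n : nat) (e : 'I_n -> M),
    forall x, exists c : 'I_n -> R, x = \sum_i c i *: e i.

(* Main.v *)
(* Put K = Frac Z and D = K (x)_Z A. Clearing denominators shows that A embeds in
   D and that D has no zero divisors; being finite-dimensional over K, it is a
   division algebra, of dimension p^2. Let C be the centralizer of a in D. By the
   tower law dim K(a) divides dim C, which divides p^2. As a is not central,
   dim C <> p^2 and dim K(a) <> 1; hence both dimensions are p and C = K(a). So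
   every b in B_a commutes with B_a and satisfies z b \in Z[a] for some nonzero
   z in Z. *)
Require Import Defs.
From mathcomp Require Import all_boot all_order all_algebra.
From HB Require Import structures.
From mathcomp Require Import falgebra generic_quotient boolp.

Set Implicit Arguments.
Unset Strict Implicit.
Unset Printing Implicit Defensive.

Import GRing.Theory.
Local Open Scope ring_scope.
Local Open Scope quotient_scope.

(** * Extension of an injective ring morphism to the fraction field *)

Section FractionMap.

Lemma fractionP {R : idomainType} (x : {fraction R}) :
  exists n d : R, d != 0 /\ x = tofrac n / tofrac d.
Proof.
elim/quotW: x => r; exists (\n_r), (\d_r); rewrite denom_ratioP; split=> //.
unlock tofrac; rewrite -[_^-1]FracField.pi_inv -[RHS]FracField.pi_mul.
rewrite /FracField.mulf /FracField.invf.
by rewrite !numden_Ratio ?oner_neq0 ?denom_ratioP // mulr1 mul1r Ratio_numden.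
Qed.

Variables (R : idomainType) (F : fieldType) (f : {rmorphism R -> F}).
Hypothesis f_inj : injective f.

(** The quotient [f n / f d] does not depend on the chosen fraction, by cross-multiplication;
    injectivity of [f] keeps the images of denominators nonzero. *)
Lemma fraction_lift : exists phi : {rmorphism {fraction R} -> F},
  forall x, phi (tofrac x) = f x.
Proof.
have f0 d : d != 0 -> f d != 0 by move=> d0; rewrite -(rmorph0 f) inj_eq.
(* The value is fixed on all representations of [x] at once, so each ring law can later be checked
   on a convenient common denominator. *)
have ex x : exists y, forall n d, d != 0 -> x = tofrac n / tofrac d ->
    y = f n / f d.
  have [n [d [d0 ->]]] := fractionP x; exists (f n / f d) => m e e0 /eqP.
  rewrite eqr_div ?tofrac_eq0 // -!tofracM tofrac_eq => /eqP nm.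
  by apply/eqP; rewrite eqr_div ?f0 // -!rmorphM nm.
have [phi phiE] := choice ex.
have phi_tofrac x : phi (tofrac x) = f x.
  by rewrite (phiE _ x 1) ?oner_neq0 ?rmorph1 ?divr1.
have phiB : zmod_morphism phi.
  move=> x y; have [n [d [d0 xE]]] := fractionP x.
  have [m [e [e0 yE]]] := fractionP y.
  rewrite (phiE x n d) // (phiE y m e) // (phiE _ (n * e - m * d) (d * e)).
  - by rewrite rmorphB !rmorphM -[in RHS]mulNr addf_div ?f0 // mulNr.
  - by rewrite mulf_neq0.
  - by rewrite xE yE -mulNr addf_div ?tofrac_eq0 // mulNr tofracB !tofracM.
have phiM : monoid_morphism phi.
  split=> [|x y]; first by rewrite -tofrac1 phi_tofrac rmorph1.
  have [n [d [d0 xE]]] := fractionP x; have [m [e [e0 yE]]] := fractionP y.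
  rewrite (phiE x n d) // (phiE y m e) // (phiE _ (n * m) (d * e)).
  - by rewrite !rmorphM mulf_div.
  - by rewrite mulf_neq0.
  - by rewrite xE yE mulf_div !tofracM.
pose phiA := GRing.isZmodMorphism.Build _ _ phi phiB.
pose phiMM := GRing.isMonoidMorphism.Build _ _ phi phiM.
by exists (HB.pack phi phiA phiMM : {rmorphism _ -> _}).
Qed.

End FractionMap.

(** * Common denominators of formal sums, and the kernel of [M -> K (x) M] *)

Section TorsionFree.
Variables (R : idomainType) (M : lmodType R).
Local Notation K := {fraction R}.
Local Notation "x %:F" := (tofrac x).

(* [d] is a common denominator of the coefficients of the formal sum [s], and [m]
   is [d] times [s], computed in [M]. Two equivalent sums have a common such pair
   [(d, m)], which bounds the kernel of [M -> K (x) M] without constructing the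
   localization of [M]. *)
Definition clears (d : R) (s : seq (K * M)) (m : M) : Prop :=
  exists t : seq (R * M),
    [seq (d%:F * u.1, u.2) | u <- s] = [seq (v.1%:F, v.2) | v <- t]
    /\ m = \sum_(v <- t) v.1 *: v.2.

(** Since [tofrac] is injective, the list [t] of numerators is itself determined by [d] and [s]. *)
Lemma clears_uniq d s m n : clears d s m -> clears d s n -> m = n.
Proof.
move=> [t [st ->]] [u [su ->]]; suff -> : t = u by [].
have inj : injective (fun v : R * M => (v.1%:F, v.2)).
  by move=> [x k] [y l] [/eqP]; rewrite tofrac_eq => /eqP-> ->.
by apply: (inj_map inj); rewrite -st -su.
Qed.

Lemma clearsM e d s m : clears d s m -> clears (e * d) s (e *: m).
Proof.
move=> [t [st ->]]; exists [seq (e * v.1, v.2) | v <- t]; split.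
  have -> : [seq ((e * d)%:F * u.1, u.2) | u <- s] =
      [seq (e%:F * v.1, v.2) | v <- [seq (d%:F * u.1, u.2) | u <- s]].
    by rewrite -map_comp; apply: eq_map => u /=; rewrite rmorphM mulrA.
  by rewrite st -!map_comp; apply: eq_map => u /=; rewrite rmorphM.
rewrite big_map scaler_sumr; apply: eq_bigr => v _ /=.
by rewrite scalerA.
Qed.

Lemma clears_cat d s t m n :
  clears d s m -> clears d t n -> clears d (s ++ t) (m + n).
Proof.
move=> [u [su ->]] [v [tv ->]]; exists (u ++ v).
by rewrite !map_cat su tv big_cat.
Qed.

Lemma clears1 d c z m : d%:F * c = z%:F -> clears d [:: (c, m)] (z *: m).
Proof. by move=> dc; exists [:: (z, m)]; rewrite /= dc big_seq1. Qed.

Lemma clear_fraction (c : K) : exists d z, d != 0 /\ d%:F * c = z%:F.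
Proof.
have [z [d [d0 ->]]] := fractionP c; exists d, z; split=> //.
by rewrite mulrCA divff ?mulr1 // tofrac_eq0.
Qed.

Lemma clears_ex s : exists d m, d != 0 /\ clears d s m.
Proof.
elim: s => [|[c n] s [d [m [d0 dm]]]].
  by exists 1, 0; rewrite oner_neq0; split=> //; exists [::]; rewrite big_nil.
have [e [z [e0 ez]]] := clear_fraction c.
exists (d * e), (d *: (z *: n) + e *: m); rewrite mulf_neq0 //; split=> //.
rewrite -cat1s; apply: clears_cat; first exact/clearsM/clears1.
by rewrite mulrC; apply: clearsM.
Qed.

(** Induction on the generating relations; wherever two denominators meet, their product serves as
    the common one. *)
Lemma tensor_eq_clears s t : tensor_eq (@tofrac R) s t ->
  exists d m, [/\ d != 0, clears d s m & clears d t m].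
Proof.
elim=> {s t}.
- by move=> s; have [d [m [d0 dm]]] := clears_ex s; exists d, m.
- by move=> s t _ [d [m [d0 ? ?]]]; exists d, m.
- move=> s t u _ [d [m [d0 sm tm]]] _ [e [n [e0 tn un]]].
  exists (d * e), (d *: n); rewrite mulf_neq0 //; split=> //; last exact: clearsM.
  (* Both sides arise by clearing the middle list [t] with the same denominator [d * e]. *)
  have -> : d *: n = e *: m.
    by apply: clears_uniq (clearsM d tn) _; rewrite mulrC; apply: clearsM.
  by rewrite mulrC; apply: clearsM.
- move=> s s' t t' _ [d [m [d0 sm tm]]] _ [e [n [e0 tn un]]].
  exists (d * e), (e *: m + d *: n); rewrite mulf_neq0 //; split=> //.
    by apply: clears_cat; [rewrite mulrC|]; apply: clearsM.
  by apply: clears_cat; [rewrite mulrC|]; apply: clearsM.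
- move=> s t; have [d [m [d0 dm]]] := clears_ex s.
  have [e [n [e0 en]]] := clears_ex t.
  exists (d * e), (e *: m + d *: n); rewrite mulf_neq0 //; split=> //.
    by apply: clears_cat; [rewrite mulrC|]; apply: clearsM.
  by rewrite addrC; apply: clears_cat; [|rewrite mulrC]; apply: clearsM.
- move=> m; exists 1, 0; rewrite oner_neq0; split=> //.
    by rewrite -(scale0r m); apply: clears1; rewrite mulr0 rmorph0.
  by exists [::]; rewrite big_nil.
- move=> c c' m; have [d [z [d0 dz]]] := clear_fraction c.
  have [e [y [e0 ey]]] := clear_fraction c'.
  have hc : (d * e)%:F * c = (e * z)%:F by rewrite !tofracM -dz mulrA (mulrC e%:F).
  have hc' : (d * e)%:F * c' = (d * y)%:F by rewrite !tofracM -ey mulrA.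
  exists (d * e), ((e * z + d * y) *: m); rewrite mulf_neq0 //; split=> //.
    by apply: clears1; rewrite mulrDr hc hc' rmorphD.
  by rewrite scalerDl; apply: (@clears_cat _ [:: _] [:: _]); apply: clears1.
- move=> c m n; have [d [z [d0 dz]]] := clear_fraction c.
  exists d, (z *: (m + n)); split=> //; first exact: clears1.
  by rewrite scalerDr; apply: (@clears_cat _ [:: _] [:: _]); apply: clears1.
- move=> c r m; have [d [z [d0 dz]]] := clear_fraction c.
  exists d, ((z * r) *: m); split=> //.
    by apply: clears1; rewrite mulrA dz rmorphM.
  by rewrite -scalerA; apply: clears1.
Qed.

(** The zero tensor is the class of the empty list, which clears only to [0], whereas [d] clears
    [1 (x) x] to [d *: x]. *)
Lemma tensor1_torsion (x : M) :
  tensor (@tofrac R) 1 x = 0 -> exists2 d : R, d != 0 & d *: x = 0.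
Proof.
move=> /tensor_classP/tensor_eq_clears [d [m [d0 dx dn]]]; exists d => //.
have -> : d *: x = m.
  by apply: (@clears_uniq d [:: (1, x)]) => //; apply: clears1; rewrite mulr1.
by apply: clears_uniq dn _; exists [::]; rewrite big_nil.
Qed.

Lemma tensor1Z (r : R) (m : M) :
  tensor (@tofrac R) 1 (r *: m) = r%:F *: tensor (@tofrac R) 1 m.
Proof. by rewrite tensorZ -tensor_balanced mulr1 mul1r. Qed.

End TorsionFree.

Lemma tensor_ind (R K : comNzRingType) (f : {rmorphism R -> K}) (M : lmodType R)
    (P : baseChange f M -> Prop) :
    P 0 -> (forall x y, P x -> P y -> P (x + y)) ->
    (forall c m, P (tensor f c m)) -> forall x, P x.
Proof.
by move=> P0 PD Pt; elim/tensor_classW=> s; rewrite tensor_classE; apply: big_ind.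
Qed.

(** * The ring and algebra structure on [D = K (x)_Z A], and the embedding of [A] *)

Section CentralLocalization.
Variable A : domainType.
Local Notation Z := (centerRing A).
Local Notation K := {fraction Z}.

Definition centralLocalization : Type :=
  baseChange (@tofrac Z) (centerModule A).
Local Notation D := centralLocalization.

HB.instance Definition _ := GRing.Lmodule.on D.

Definition ctensor (c : K) (x : A) : D :=
  tensor (@tofrac Z) c (x : centerModule A).

Lemma ctensorDl c d x : ctensor (c + d) x = ctensor c x + ctensor d x.
Proof. exact: tensorDl. Qed.
Lemma ctensorDr c x y : ctensor c (x + y) = ctensor c x + ctensor c y.
Proof. exact: tensorDr. Qed.
Lemma ctensorZ a c x : a *: ctensor c x = ctensor (a * c) x.
Proof. exact: tensorZ. Qed.
Lemma ctensor_balanced c (r : Z) (x : A) :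
  ctensor (c * tofrac r) x = ctensor c (val r * x).
Proof. exact: tensor_balanced. Qed.
Lemma ctensor_ind (P : D -> Prop) :
    P 0 -> (forall x y, P x -> P y -> P (x + y)) ->
    (forall c x, P (ctensor c x)) -> forall x, P x.
Proof. exact: tensor_ind. Qed.
Lemma ctensor0l x : ctensor 0 x = 0.
Proof. by apply: (addrI (ctensor 0 x)); rewrite -ctensorDl !addr0. Qed.

(** The values lie in the quotient already, so only independence of the two argument lists remains
    to be checked. *)
Definition seq_mul (s t : seq (K * centerModule A)) : D :=
  \sum_(u <- s) \sum_(v <- t) ctensor (u.1 * v.1) ((u.2 : A) * (v.2 : A)).

Lemma seq_mul_eql s s' t : tensor_eq (@tofrac Z) s s' -> seq_mul s t = seq_mul s' t.
Proof.
rewrite /seq_mul; elim=> {s s'}.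
- by [].
- by move=> s s' _ ->.
- by move=> s s' s'' _ -> _ ->.
- by move=> s s' u u' _ e1 _ e2; rewrite !big_cat e1 e2.
- by move=> s u; rewrite !big_cat /= addrC.
- by move=> m; rewrite big_seq1 big_nil big1 // => v _; rewrite mul0r ctensor0l.
- move=> c d m; rewrite !(big_cons, big_nil) !addr0 -big_split.
  by apply: eq_bigr => v _; rewrite /= mulrDl ctensorDl.
- move=> c m n; rewrite !(big_cons, big_nil) !addr0 -big_split.
  by apply: eq_bigr => v _; rewrite /= -ctensorDr -mulrDl.
- move=> c r m; rewrite !big_seq1; apply: eq_bigr => v _ /=.
  by rewrite mulrAC ctensor_balanced mulrA.
Qed.

Lemma seq_mul_eqr s t t' : tensor_eq (@tofrac Z) t t' -> seq_mul s t = seq_mul s t'.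
Proof.
rewrite /seq_mul => tt'; apply: eq_bigr => u _; elim: tt' => {t t'}.
- by [].
- by move=> t t' _ ->.
- by move=> t t' t'' _ -> _ ->.
- by move=> t t' u1 u' _ e1 _ e2; rewrite !big_cat e1 e2.
- by move=> t u1; rewrite !big_cat /= addrC.
- by move=> m; rewrite big_seq1 big_nil mulr0 ctensor0l.
- by move=> c d m; rewrite !(big_cons, big_nil) !addr0 mulrDr ctensorDl.
- by move=> c m n; rewrite !(big_cons, big_nil) !addr0 -ctensorDr -mulrDr.
- move=> c r m; rewrite !big_seq1 /= mulrA ctensor_balanced.
  (* The scalar [r] acts on the right-hand factor and has to move past the left-hand one, which its
     centrality permits. *)
  rewrite [r *: m]/((val r : A) * (m : A)) !mulrA.
  by rewrite (centerP _ (valP r)).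
Qed.

Definition cl_mul (x y : D) : D := seq_mul (tensor_repr x) (tensor_repr y).

Lemma cl_mulE s t : cl_mul (tensor_class _ s) (tensor_class _ t) = seq_mul s t.
Proof.
by rewrite /cl_mul (seq_mul_eql _ (tensor_repr_class _ s))
  (seq_mul_eqr _ (tensor_repr_class _ t)).
Qed.

Lemma cl_mul_tensor c d x y :
  cl_mul (ctensor c x) (ctensor d y) = ctensor (c * d) (x * y).
Proof. by rewrite cl_mulE /seq_mul !big_seq1. Qed.

Lemma cl_mulDl : left_distributive cl_mul +%R.
Proof.
elim/tensor_classW=> s; elim/tensor_classW=> t; elim/tensor_classW=> u.
by rewrite [tensor_class _ s + _]base_change_addE !cl_mulE /seq_mul big_cat.
Qed.

Lemma cl_mulDr : right_distributive cl_mul +%R.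
Proof.
elim/tensor_classW=> s; elim/tensor_classW=> t; elim/tensor_classW=> u.
rewrite [tensor_class _ t + _]base_change_addE !cl_mulE /seq_mul -big_split.
by apply: eq_bigr => v _; rewrite big_cat.
Qed.

Lemma cl_mul0r x : cl_mul 0 x = 0.
Proof. by apply: (addrI (cl_mul 0 x)); rewrite -cl_mulDl !addr0. Qed.

Lemma cl_mulr0 x : cl_mul x 0 = 0.
Proof. by apply: (addrI (cl_mul x 0)); rewrite -cl_mulDr !addr0. Qed.

Lemma cl_mulA : associative cl_mul.
Proof.
elim/ctensor_ind=> [y z|x x' IH IH' y z|c x]; first by rewrite !cl_mul0r.
  by rewrite !cl_mulDl IH IH'.
elim/ctensor_ind=> [z|y y' IH IH' z|d y]; first by rewrite !(cl_mul0r, cl_mulr0).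
  by rewrite !(cl_mulDl, cl_mulDr) IH IH'.
elim/ctensor_ind=> [|z z' IH IH'|e z]; first by rewrite !cl_mulr0.
  by rewrite !cl_mulDr IH IH'.
by rewrite !cl_mul_tensor !mulrA.
Qed.

Lemma cl_mul1l : left_id (ctensor 1 1) cl_mul.
Proof.
elim/ctensor_ind=> [|x x' IH IH'|c x]; first by rewrite cl_mulr0.
  by rewrite cl_mulDr IH IH'.
by rewrite cl_mul_tensor !mul1r.
Qed.

Lemma cl_mul1r : right_id (ctensor 1 1) cl_mul.
Proof.
elim/ctensor_ind=> [|x x' IH IH'|c x]; first by rewrite cl_mul0r.
  by rewrite cl_mulDl IH IH'.
by rewrite cl_mul_tensor !mulr1.
Qed.

(** The kernel consists of [Z]-torsion elements, and a domain has no nonzero torsion over its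
    center. *)
Lemma ctensor1_eq0 x : ctensor 1 x = 0 -> x = 0.
Proof.
move=> /tensor1_torsion [d d0] /(@domain_mulf_eq0 A)/orP[/eqP h|/eqP //].
by case/eqP: d0; apply: val_inj; rewrite rmorph0.
Qed.

Lemma cl_oner_neq0 : ctensor 1 1 != 0.
Proof. by apply/eqP=> /ctensor1_eq0/eqP; rewrite oner_eq0. Qed.

HB.instance Definition _ := GRing.Zmodule_isNzRing.Build D
  cl_mulA cl_mul1l cl_mul1r cl_mulDl cl_mulDr cl_oner_neq0.

Lemma cl_scaleAl (k : K) (x y : D) : k *: (x * y) = (k *: x) * y.
Proof.
elim/ctensor_ind: x => [|x x' IH IH'|c x].
- by rewrite !(mul0r, scaler0).
- by rewrite mulrDl !scalerDr mulrDl IH IH'.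
elim/ctensor_ind: y => [|y y' IH IH'|d y].
- by rewrite !(mulr0, scaler0).
- by rewrite !mulrDr !scalerDr IH IH'.
by rewrite !(ctensorZ, cl_mul_tensor) [_ * _ in LHS]cl_mul_tensor
  [_ * _ in RHS]cl_mul_tensor ctensorZ mulrA.
Qed.

Lemma cl_scaleAr (k : K) (x y : D) : k *: (x * y) = x * (k *: y).
Proof.
elim/ctensor_ind: x => [|x x' IH IH'|c x].
- by rewrite !(mul0r, scaler0).
- by rewrite !mulrDl !scalerDr IH IH'.
elim/ctensor_ind: y => [|y y' IH IH'|d y].
- by rewrite !(mulr0, scaler0).
- by rewrite mulrDr !scalerDr mulrDr IH IH'.
by rewrite !(ctensorZ, cl_mul_tensor) [_ * _ in LHS]cl_mul_tensor
  [_ * _ in RHS]cl_mul_tensor ctensorZ mulrCA.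
Qed.

HB.instance Definition _ := GRing.Lmodule_isLalgebra.Build K D cl_scaleAl.
HB.instance Definition _ := GRing.Lalgebra_isAlgebra.Build K D cl_scaleAr.

Definition cl_incl : A -> D := ctensor 1.

Lemma cl_incl_is_zmod_morphism : zmod_morphism cl_incl.
Proof.
move=> x y; apply: (addIr (cl_incl y)).
by rewrite /cl_incl -ctensorDr !subrK.
Qed.

Lemma cl_incl_is_monoid_morphism : monoid_morphism cl_incl.
Proof.
by split=> // x y; rewrite [RHS]cl_mul_tensor mulr1.
Qed.

HB.instance Definition _ := GRing.isZmodMorphism.Build A D cl_incl
  cl_incl_is_zmod_morphism.
HB.instance Definition _ := GRing.isMonoidMorphism.Build A D cl_incl
  cl_incl_is_monoid_morphism.

Lemma cl_incl_inj : injective cl_incl.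
Proof. exact/raddf_inj/ctensor1_eq0. Qed.

Lemma cl_incl_scale (z : Z) (x : A) :
  cl_incl (val z * x) = tofrac z *: cl_incl x.
Proof. exact: tensor1Z. Qed.

Lemma cl_clear (x : D) :
  exists (z : Z) (y : A), z != 0 /\ tofrac z *: x = cl_incl y.
Proof.
elim/ctensor_ind: x => [|x x' [z [y [z0 zx]]] [z' [y' [z0' zx']]]|c x].
- by exists 1, 0; rewrite oner_neq0 scaler0 rmorph0.
- exists (z * z'), (val z' * y + val z * y'); rewrite mulf_neq0 //; split=> //.
  rewrite rmorphD /= !cl_incl_scale -zx -zx' !scalerA -!tofracM scalerDr.
  by rewrite (mulrC z').
have [z [y [z0 zc]]] := @clear_fraction Z c.
exists z, (val y * x); split=> //.
by rewrite cl_incl_scale !ctensorZ zc mulr1.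
Qed.

(** Scaling both factors into [A] gives numerators with product zero, so one of them vanishes; its
    factor then vanishes too, the denominator being nonzero in [K]. *)
Lemma cl_integral (x y : D) : x * y = 0 -> x = 0 \/ y = 0.
Proof.
have [z [x' [z0 zx]]] := cl_clear x; have [t [y' [t0 ty]]] := cl_clear y.
move=> xy0; have : x' * y' = 0.
  apply: cl_incl_inj; rewrite rmorphM /= -zx -ty -scalerAl -scalerAr xy0.
  by rewrite !scaler0 rmorph0.
move=> /(@domain_mulf_eq0 A)/orP[/eqP h|/eqP h]; [left; move: zx|right; move: ty].
  rewrite h rmorph0 => /eqP; rewrite scaler_eq0 tofrac_eq0 (negPf z0).
  by move/eqP.
rewrite h rmorph0 => /eqP; rewrite scaler_eq0 tofrac_eq0 (negPf t0).
by move/eqP.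
Qed.

End CentralLocalization.

(** * Finite-dimensional division algebras and centralizers in dimension [p ^ 2] *)

Section DivisionAlgebra.
Variables (K : fieldType) (D : falgType K).

(** Left and right multiplication by [x] are injective endomorphisms of a finite-dimensional space,
    hence bijective; the preimages of [1] are one-sided inverses, which coincide. *)
Lemma falgebra_field_axiom :
  (forall x y : D, x * y = 0 -> x = 0 \/ y = 0) -> GRing.field_axiom D.
Proof.
move=> integral x x0.
have ker0 (f : 'End(D)) : (forall y, f y = 0 -> y = 0) -> lker f == 0%VS.
  by move=> fi; apply/lker0P/raddf_inj.
have kl : lker (amull x) == 0%VS.
  by apply: ker0 => y; rewrite lfunE => /= /integral[/eqP|//]; rewrite (negPf x0).
have kr : lker (amulr x) == 0%VS.
  by apply: ker0 => y; rewrite lfunE => /= /integral[//|/eqP]; rewrite (negPf x0).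
have := lker0_lfunVK kl 1; have := lker0_lfunVK kr 1.
rewrite !lfunE /=; set y := (_^-1%VF 1); set z := (_^-1%VF 1) => yx xz.
apply/unitrP; exists y; split=> //.
by have -> : y = z by rewrite -[y]mulr1 -xz mulrA yx mul1r.
Qed.

(** Here [agenv <[a]>] is [K[a]], and [skew_field_dimS] turns the chain from [K[a]] through the
    centralizer up to [D] into divisibilities of dimensions. *)
Lemma cent1v_agenv (p : nat) (a b : D) :
    prime p -> GRing.field_axiom D -> \dim {:D} = (p ^ 2)%N ->
    a * b != b * a ->
  'C[a]%VS = agenv <[a]>.
Proof.
move=> p_pr fieldD dimD nab.
have sub : (agenv <[a]> <= 'C[a])%VS.
  apply: agenv_sub_modl; first by rewrite -memvE cent1v1.
  apply: (subv_trans _ (asubv 'C[a]%AS)); apply: prodvSl.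
  by rewrite -memvE; apply: cent1v_id.
have dC : (\dim 'C[a] %| p ^ 2)%N.
  by rewrite -dimD; apply: (@skew_field_dimS _ _ fieldD 'C[a]%AS {:D}%AS (subvf _)).
have dK : (\dim (agenv <[a]>) %| \dim 'C[a])%N.
  exact: (@skew_field_dimS _ _ fieldD (agenv_aspace <[a]>) 'C[a]%AS sub).
(* With full dimension the centralizer would be [D] and contain [b]. *)
have C_neq : \dim 'C[a] != (p ^ 2)%N.
  rewrite -dimD (dimv_leqif_eq (subvf _)); apply: contraNneq nab => Ca.
  by rewrite eq_sym; apply/eqP/cent1vP; rewrite Ca memvf.
(* In dimension one [K[a]] would be the line of [1], making [a] a scalar. *)
have K_neq : \dim (agenv <[a]>) != 1%N.
  apply: contraNneq nab => dK1.
  have /eqP K1 : (1 == agenv <[a]>)%VS.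
    by rewrite -(dimv_leqif_eq (sub1_agenv _)) dK1 dimv1.
  have : a \in 1%VS by rewrite K1 memvE sub_agenv.
  by case/vlineP=> k ->; rewrite -scalerAl -scalerAr mul1r mulr1.
apply/eqP; rewrite eq_sym -(dimv_leqif_eq sub); apply/eqP.
(* The centralizer has dimension [p ^ i] with [i <= 2]. Exponent 0 contradicts [K_neq] and exponent
   2 contradicts [C_neq]; for exponent 1, primality leaves only [p] for the dimension of [K[a]]. *)
move: dC; case/(dvdn_pfactor _ _ p_pr) => [[|[|[|//]]]] _ dC.
- by move: dK; rewrite dC dvdn1 (negPf K_neq).
- move: dK; rewrite dC expn1 => /(proj2 (primeP p_pr)).
  by rewrite (negPf K_neq) => /eqP.
- by rewrite dC eqxx in C_neq.
Qed.

(** By definition [agenv] is a finite sum of powers of [<[a]>], and the [i]-th power is the line of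
    [a ^+ i]. *)
Lemma agenv_line_horner (a x : D) :
  x \in agenv <[a]> -> exists q : {poly K}, x = horner_alg a q.
Proof.
case/memv_sumP=> v vE ->.
have /choice[q qE] : forall i : 'I_(\dim {:D}), exists q : {poly K},
    v i = horner_alg a q.
  move=> i; have := vE i isT; rewrite expv_line => /vlineP[k ->].
  exists (k *: 'X^i).
  by rewrite linearZ rmorphXn /= horner_algX mulr_algl.
by exists (\sum_i q i); rewrite rmorph_sum; apply: eq_bigr => i _; exact: qE.
Qed.

End DivisionAlgebra.

(** The coordinates supplied by [has_rank] make the localization an [falgType]. The later argument
    relies only on the four properties listed here, not on the tensor construction. *)
Lemma cl_division_falgebra (A : domainType) (n : nat) :
    has_rank (centerModule A) n ->
  exists D : falgType {fraction centerRing A},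
  exists iota : {rmorphism A -> D},
    [/\ \dim {:D} = n, GRing.field_axiom D, injective iota &
      forall (z : centerRing A) x, iota (val z * x) = tofrac z *: iota x].
Proof.
case=> V.
pose D0 : vectType {fraction centerRing A} := HB.pack (centralLocalization A)
  (Lmodule_hasFinDim.Build _ (centralLocalization A) V).
pose D : falgType {fraction centerRing A} := HB.pack (centralLocalization A) D0
  (Algebra_isFalgebra.Build _ D0).
exists D, (@cl_incl A : {rmorphism A -> D}); split.
- by rewrite dimvf.
- exact/falgebra_field_axiom/cl_integral.
- exact: cl_incl_inj.
- exact: cl_incl_scale.
Qed.

(** * Nested commutative subrings, their fraction fields, and denominators over [Z[a]] *)

Lemma center_sub_adjoin (A : domainType) (a : A) : {subset center A <= adjoin a}.
Proof. by move=> z zZ; apply/adjoinP=> S _ /(_ z zZ). Qed.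

Lemma mem_adjoin (A : domainType) (a : A) : a \in adjoin a.
Proof. exact/adjoinP. Qed.

Lemma com_subring_incl_is_zmod_morphism (A : domainType) (S T : comSubring A)
  (sST : {subset S <= T}) : zmod_morphism (com_subring_incl sST).
Proof. by move=> x y; apply: val_inj; rewrite rmorphB. Qed.

Lemma com_subring_incl_is_monoid_morphism (A : domainType) (S T : comSubring A)
  (sST : {subset S <= T}) : monoid_morphism (com_subring_incl sST).
Proof. by split=> [|x y]; apply: val_inj; rewrite ?rmorph1 ?rmorphM. Qed.

HB.instance Definition _ (A : domainType) (S T : comSubring A)
    (sST : {subset S <= T}) :=
  GRing.isZmodMorphism.Build S T (com_subring_incl sST)
    (com_subring_incl_is_zmod_morphism sST).
HB.instance Definition _ (A : domainType) (S T : comSubring A)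
    (sST : {subset S <= T}) :=
  GRing.isMonoidMorphism.Build S T (com_subring_incl sST)
    (com_subring_incl_is_monoid_morphism sST).

Lemma com_subring_incl_inj (A : domainType) (S T : comSubring A)
  (sST : {subset S <= T}) : injective (com_subring_incl sST).
Proof. by move=> x y /(congr1 val) /= xy; apply: val_inj. Qed.

(** Injectivity is automatic for a morphism of fields; for surjectivity, each [y] in [T] is the
    image of the fraction [(d * y) / d] over [S]. *)
Lemma fraction_incl_bij (A : domainType) (S T : comSubring A)
    (sST : {subset S <= T}) :
    (forall y, y \in T -> exists2 d, d != 0 & d \in S /\ d * y \in S) ->
  exists phi : {rmorphism {fraction S} -> {fraction T}},
    (forall x, phi (tofrac x) = tofrac (com_subring_incl sST x)) /\ bijective phi.
Proof.
move=> clear; pose f : {rmorphism S -> {fraction T}} :=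
  @tofrac T \o com_subring_incl sST.
have f_inj : injective f.
  by move=> x y /eqP; rewrite /= tofrac_eq => /eqP/com_subring_incl_inj.
have [phi phiE] := fraction_lift f_inj; exists phi; split=> //.
have phi_surj (t : T) : exists x, phi x = tofrac t.
  have [d d0 [dS dyS]] := clear _ (valP t).
  pose d' : S := InComSubring dS; pose y' : S := InComSubring dyS.
  have d'0 : com_subring_incl sST d' != 0.
    by apply: contraNneq d0 => /(congr1 val)/= ->.
  exists (tofrac y' / tofrac d').
  rewrite fmorph_div !phiE /=; apply: (canLR (mulfK _)); rewrite ?tofrac_eq0 //.
  by rewrite -tofracM; congr tofrac; rewrite mulrC; apply: val_inj; rewrite rmorphM.
have surj y : exists x, phi x == y.
  have [n [d [_ ->]]] := fractionP y; have [u uE] := phi_surj n.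
  by have [v vE] := phi_surj d; exists (u / v); rewrite fmorph_div uE vE.
exists (fun y => xchoose (surj y)) => [x|y]; last exact/eqP/(xchooseP (surj y)).
exact/(fmorph_inj phi)/eqP/(xchooseP (surj _)).
Qed.

(** Induction along Horner's scheme, clearing one coefficient of [q] at a time. *)
Lemma horner_adjoin (A : domainType) (D : falgType {fraction centerRing A})
    (iota : {rmorphism A -> D}) (a : A) (q : {poly {fraction centerRing A}}) :
    (forall (z : centerRing A) x, iota (val z * x) = tofrac z *: iota x) ->
  exists (z : centerRing A) (y : A),
    [/\ z != 0, y \in adjoin a & tofrac z *: horner_alg (iota a) q = iota y].
Proof.
move=> iotaZ; have [adj1 adjB adjM] := adjoin_subring_closed a.
have adj0 : 0 \in adjoin a by rewrite -(subrr 1) adjB.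
have adjD x y : x \in adjoin a -> y \in adjoin a -> x + y \in adjoin a.
  by move=> xa ya; rewrite -[y]opprK -[- y]sub0r adjB ?adjB.
have adjZ (z : centerRing A) : val z \in adjoin a.
  by apply: center_sub_adjoin; apply: valP.
elim/poly_ind: q => [|q c [z [y [z0 ya zy]]]].
  by exists 1, 0; rewrite oner_neq0 !rmorph0 scaler0.
have [d [w [d0 dc]]] := clear_fraction c.
(* With [z] clearing [q(a)] to [y] and [d] clearing [c] to [w], multiplying [q(a) a + c] by [d z]
   gives [d y a + w z]. *)
exists (d * z), (val d * y * a + val w * val z); split.
- by rewrite mulf_neq0.
- exact: adjD (adjM _ _ (adjM _ _ (adjZ d) ya) (mem_adjoin a))
    (adjM _ _ (adjZ w) (adjZ z)).
have iota_z : iota (val z) = (tofrac z)%:A by rewrite -[val z]mulr1 iotaZ rmorph1.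
rewrite [RHS]rmorphD /= -mulrA !iotaZ iota_z rmorphM /= -zy.
rewrite rmorphD (rmorphM (horner_alg (iota a))) /= horner_algX horner_algC scalerDr.
by rewrite -dc -scalerAl !scalerA tofracM (mulrAC _ c).
Qed.

Unset Implicit Arguments.

Theorem lemma2p0p1 (p : nat) (p_prime : prime p) (A : domainType)
    (fgA : fin_gen (centerModule A)) (rankA : has_rank (centerModule A) (p ^ 2)%N)
    (a : A) (aNZ : a \notin center A) :
  exists comm_a : {in centralizer a &, forall x y : A, x * y = y * x},
  exists phi : {rmorphism {fraction adjoinRing a} ->
                          {fraction centralizerRing comm_a}},
    (forall x : adjoinRing a,
       phi (tofrac x) = tofrac (adjoin_incl comm_a x))
    /\ bijective phi.
Proof.
have [D [iota [dimD fieldD iota_inj iotaZ]]] := cl_division_falgebra rankA.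
have [b nab] : exists b, a * b != b * a.
  apply: contrapT => h; case/negP: aNZ; apply/centerP=> b; apply/eqP.
  by apply: contrapT => /negP nab; apply: h; exists b.
have CE : 'C[iota a]%VS = agenv <[iota a]>.
  apply: (cent1v_agenv (b := iota b) p_prime fieldD dimD).
  by rewrite -!rmorphM (inj_eq iota_inj).
have mem_agenv x : x \in centralizer a -> iota x \in agenv <[iota a]>.
  by move=> /centralizerP xa; rewrite -CE; apply/cent1vP; rewrite -!rmorphM -xa.
have comm_a : {in centralizer a &, forall x y : A, x * y = y * x}.
  (* Polynomials in [iota a] commute with each other, and injectivity of [iota] brings this back to
     [A]. *)
  move=> x y /mem_agenv/agenv_line_horner[q xE] /mem_agenv/agenv_line_horner[r yE].
  by apply: iota_inj; rewrite !rmorphM /= xE yE -!rmorphM mulrC.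
exists comm_a; apply: fraction_incl_bij => y /mem_agenv/agenv_line_horner[q yE].
(* The denominator [z] is central, hence in [Z[a]], and [z y] equals [x] in [Z[a]]. *)
have [z [x [z0 xa zx]]] := horner_adjoin a q iotaZ.
exists (val z); first by apply: contraNneq z0 => z0; apply/eqP/val_inj.
split; first exact/center_sub_adjoin/valP.
suff -> : val z * y = x by [].
by apply: iota_inj; rewrite iotaZ yE.
Qed.
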